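(* Let $D$ be a (proper) distribution of pegs on a finite simple graph $G$. Then $\mathrm{Reach}_a(D)=\mathrm{Reach}(D)$.
   Context: A (proper) distribution of pegs on $G$ is a subset $D \subseteq V(G)$. If $u,v \in D$ are distinct adjacent vertices and $w \notin D$ is a vertex adjacent to $v$, the pegging move (jumping $u$ over $v$ into $w$) replaces $D$ by $(D\setminus\{u,v\})\cup\{w\}$. $\mathrm{Reach}(D)$ is the set of vertices $t$ such that some finite (possibly empty) sequence of pegging moves starting from $D$ ends in a distribution containing $t$. Labeled pegs: let $S_G=\{u_i : u\in V(G), i\in\mathbb{Z}\}$ ($u_i$ means peg $i$ sits on vertex $u$). A multi-distribution is a finite subset $M\subseteq S_G$ such that $u_i,v_i\in M$ implies $u=v$ (several pegs may sit on one vertex). Moves on a multi-distribution $M$: (1) stacking move: if $u,v,w$ are distinct vertices, $v$ is adjacent to both $u$ and $w$, and $u_i,v_j\in M$, replace $M$ by $(M\setminus\{u_i,v_j\})\cup\{w_i\}$; (2) pebbling move: if $u,w$ are distinct adjacent vertices, $i\neq j$, and $u_i,u_j\in M$, replace $M$ by $(M\setminus\{u_i,u_j\})\cup\{w_i\}$; (3) removal move: if $u_i\in M$, replace $M$ by $M\setminus\{u_i\}$. A proper distribution is regarded as a multi-distribution by giving its pegs distinct labels. $\mathrm{Reach}_a(D)$ is the set of vertices $t$ such that some finite sequence of stacking, pebbling and removal moves starting from $D$ yields a multi-distribution containing $t_i$ for some $i$. *)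

(* Defs.v *)
From HB Require Import structures.
From Stdlib Require Import Relations.
From mathcomp Require Import all_boot all_order all_algebra.
From mathcomp Require Import finmap boolp classical_sets.

Set Implicit Arguments.
Unset Strict Implicit.
Unset Printing Implicit Defensive.

Record sgraph := SGraph {
  vertex :> finType;
  adj : rel vertex;
  adj_sym : symmetric adj;
  adj_irr : irreflexive adj
}.

Section Pegging.
Variable G : sgraph.

Definition pegging_move (D D' : {set G}) : Prop :=
  exists u v w : G,
    [/\ u \in D, v \in D, u <> v & adj u v] /\
    [/\ w \notin D, adj v w & D' = (D :\: [set u; v]) :|: [set w]].

Definition Reach (D : {set G}) : set G :=
  [set t | exists D', clos_refl_trans _ pegging_move D D' /\ t \in D']%classic.

Local Open Scope fset_scope.

(* The pair (u, i) encodes u_i: peg i sits on vertex u. *)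
Notation labeled_pegs := {fset (G * int)}.

Definition is_multidist (M : labeled_pegs) : Prop :=
  forall (u v : G) (i : int), (u, i) \in M -> (v, i) \in M -> u = v.

Definition stacking_move (M M' : labeled_pegs) : Prop :=
  exists (u v w : G) (i j : int),
    [/\ u <> v, u <> w & v <> w] /\
    [/\ adj v u, adj v w, (u, i) \in M, (v, j) \in M
      & M' = (M `\` [fset (u, i); (v, j)]) `|` [fset (w, i)]].

Definition pebbling_move (M M' : labeled_pegs) : Prop :=
  exists (u w : G) (i j : int),
    [/\ u <> w, adj u w & i <> j] /\
    [/\ (u, i) \in M, (u, j) \in M
      & M' = (M `\` [fset (u, i); (u, j)]) `|` [fset (w, i)]].

Definition removal_move (M M' : labeled_pegs) : Prop :=
  exists (u : G) (i : int), (u, i) \in M /\ M' = M `\ (u, i).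

Definition multi_move (M M' : labeled_pegs) : Prop :=
  is_multidist M /\
  [\/ stacking_move M M', pebbling_move M M' | removal_move M M'].

(* The proper distribution D viewed as a multi-distribution, the peg on u
   getting the label l u; l is meant to be injective on D. *)
Definition label_dist (l : G -> int) (D : {set G}) : labeled_pegs :=
  [fset (u, l u) | u in D].

Definition Reach_a (l : G -> int) (D : {set G}) : set G :=
  [set t | exists M, clos_refl_trans _ multi_move (label_dist l D) M /\
                     exists i : int, (t, i) \in M]%classic.

Lemma label_dist_multidist (l : G -> int) (D : {set G}) :
  {in D &, injective l} -> is_multidist (label_dist l D).
Proof.
move=> l_inj u v i /imfsetP[x /= Dx [-> ->]] /imfsetP[y /= Dy [-> lxy]].
exact: l_inj.
Qed.

Lemma multi_move_multidist (M M' : labeled_pegs) :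
  multi_move M M' -> is_multidist M'.
Proof.
have rep (N : labeled_pegs) (u w : G) i (q : G * int) : is_multidist N ->
    (u, i) \in N ->
    is_multidist ((N `\` [fset (u, i); q]) `|` [fset (w, i)]).
  move=> N_ok uN.
  have no x : (x, i) \in N `\` [fset (u, i); q] -> False.
    rewrite !inE negb_or => /andP[/andP[/eqP xu _] xN].
    by case: xu; rewrite (N_ok _ _ _ xN uN).
  move=> x y k /fsetUP[xN|/fset1P[-> ->]] /fsetUP[yN|/fset1P[]] //.
  - move: xN yN; rewrite !in_fsetD => /andP[_ xN] /andP[_ yN].
    exact: N_ok xN yN.
  - by move=> _ ki; rewrite ki in xN; case: (no x).
  - by case: (no y).
case=> M_ok [[u [v [w [i [j [_ [_ _ uM _ ->]]]]]]]|
             [u [w [i [j [_ [uM _ ->]]]]]]|[u [i [_ ->]]]].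
- exact: rep.
- exact: rep.
- move=> x y k /fsetD1P[_ xM] /fsetD1P[_ yM]; exact: M_ok xM yM.
Qed.

End Pegging.

(* Main.v *)
Require Import Defs.
From Stdlib Require Import Relations.
From mathcomp Require Import all_boot all_order all_algebra.
From mathcomp Require Import finmap boolp classical_sets.
From mathcomp Require Import fintype finset.

(** The history of a labeled peg is a tree whose leaves are distinct pegs of
    [D], so a vertex of [Reach_a] has a derivation from pairwise disjoint sets
    of pegs; pebbling moves can be eliminated from such derivations.
    The core is that if [u] and [v] are derivable from disjoint subsets
    [S1], [S2] of a proper distribution [T], then proper moves from [T] reach a
    distribution containing both.  By induction on cardinality, [S1] alone has
    a proper sequence of moves to [u].  Its first move, [x] over [y] into [z],
    is either legal in [T], or blocked by a peg of [T] on [z]; then [S1] takes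
    over that peg and [S2] gets [x] and [y] in exchange, with which it can
    rebuild [z].  The exchange leaves [T] unchanged and shrinks [S1], so either
    a proper move of [T] is eventually possible, or [u] is already in [T];
    likewise for [v]. *)

Set Implicit Arguments.
Unset Strict Implicit.
Unset Printing Implicit Defensive.

(** * Derivation trees with disjoint sets of pegs *)

Section Derivations.
Variable G : sgraph.
Implicit Types (D S T : {set G}) (u v w x y z t : G).

(** The target [w] may lie in [S] or equal [u]: derivations ignore blocking, which [Reach_derives]
    later overcomes. *)
Inductive derives : {set G} -> G -> Prop :=
| derives_peg S u : u \in S -> derives S u
| derives_jump S S1 S2 u v w :
    S1 \subset S -> S2 \subset S -> [disjoint S1 & S2] ->
    adj u v -> adj v w -> derives S1 u -> derives S2 v -> derives S w.

Lemma derives_sub S T u : S \subset T -> derives S u -> derives T u.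
Proof.
move=> sST RS; case: RS sST => {S u} [S u uS|S S1 S2 u v w s1 s2 dis uv vw R1 R2] sST.
  exact/derives_peg/(subsetP sST).
exact: derives_jump (subset_trans s1 sST) (subset_trans s2 sST) dis uv vw R1 R2.
Qed.

Lemma derives_card_gt0 S u : derives S u -> 0 < #|S|.
Proof.
elim=> {S u} [S u uS|S S1 S2 u v w s1 _ _ _ _ _ h1 _ _].
  by apply/card_gt0P; exists u.
exact: leq_trans h1 (subset_leq_card s1).
Qed.

Lemma derives_neighbor S u : derives S u -> u \notin S ->
  exists T y, [/\ T \subset S, adj y u & derives T y].
Proof.
case=> {S u} [S u ->//|S S1 S2 u v w _ s2 _ _ vw _ R2 _].
by exists S2, v.
Qed.

(* To jump [y] over [u], one of the two pegs on [u] is not brought all the way: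
   it stops at the vertex [y] over which its last jump was made. *)
Lemma derives_pebbling S1 S2 u w : [disjoint S1 & S2] -> adj u w ->
  derives S1 u -> derives S2 u -> derives (S1 :|: S2) w.
Proof.
wlog u1 : S1 S2 / u \notin S1 => [IH dis uw R1 R2|dis uw R1 R2].
  have [u1|u1] := boolP (u \in S1); last exact: IH.
  by rewrite setUC; apply: IH; rewrite ?(disjointFr dis u1) // disjoint_sym.
have [T [y [sT yu Ry]]] := derives_neighbor R1 u1.
apply: (derives_jump _ (subsetUr S1 S2) _ yu uw Ry R2).
  exact: subset_trans sT (subsetUl _ _).
exact: disjointWl sT dis.
Qed.

(** The leaf [z] is replaced by the jump of [x] over [y] into [z]. As [S1] and [S2] are disjoint, at
    most one of them holds [z], so [x] and [y] are spent only once. *)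
Lemma derives_exchange S x y z t : x \notin S -> y \notin S -> x != y ->
  adj x y -> adj y z -> derives S t -> derives (S :\ z :|: [set x; y]) t.
Proof.
move=> xS yS nxy xy yz RS; elim: RS xS yS
  => {S t} [S t tS|S S1 S2 u v w s1 s2 dis uv vw R1 IH1 R2 IH2] xS yS.
  have [->|ntz] := eqVneq t z; last by apply: derives_peg; rewrite !inE ntz tS.
  apply: (@derives_jump _ [set x] [set y] x y) => //.
  - by apply/subsetP=> a; rewrite !inE => ->; rewrite ?orbT.
  - by apply/subsetP=> a; rewrite !inE => ->; rewrite ?orbT.
  - by rewrite disjoints1 inE.
  - by apply: derives_peg; rewrite inE.
  - by apply: derives_peg; rewrite inE.
have notin (A : {set G}) a : A \subset S -> a \notin S -> a \notin A.
  by move=> sAS; apply: contra => /(subsetP sAS).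
have keep (A : {set G}) : A \subset S -> z \notin A -> A \subset S :\ z :|: [set x; y].
  move=> sAS zA; apply/subsetP=> a aA; rewrite !inE (subsetP sAS _ aA) andbT.
  by case: eqP aA zA => // -> ->.
have trade (A : {set G}) : A \subset S ->
    A :\ z :|: [set x; y] \subset S :\ z :|: [set x; y].
  by move=> sAS; apply/setSU/setSD.
have dtrade (A B : {set G}) : A \subset S -> [disjoint A & B] ->
    [disjoint A & B :\ z :|: [set x; y]].
  move=> sAS dAB; rewrite disjoints_subset; apply/subsetP=> a aA.
  rewrite !inE (disjointFr dAB aA) andbF /=.
  by apply/negP=> /orP[]/eqP ea; rewrite ea (negbTE (notin _ _ sAS _)) in aA.
have [z1|z1] := boolP (z \in S1).
  have z2 : z \notin S2 by rewrite (disjointFr dis z1).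
  have R1' := IH1 (notin _ _ s1 xS) (notin _ _ s1 yS).
  apply: derives_jump (trade _ s1) (keep _ s2 z2) _ uv vw R1' R2.
  by rewrite disjoint_sym; apply: dtrade => //; rewrite disjoint_sym.
have R2' := IH2 (notin _ _ s2 xS) (notin _ _ s2 yS).
by apply: derives_jump (keep _ s1 z1) (trade _ s2) _ uv vw R1 R2'; apply: dtrade.
Qed.

Lemma pegging_move_card T T' : pegging_move T T' -> #|T'| < #|T|.
Proof.
case=> x [y [z [[xT yT /eqP nxy _] [zT _ ->]]]].
have sxy : [set x; y] \subset T by rewrite subUset !sub1set xT.
rewrite setUC cardsU1 !inE (negbTE zT) andbF cardsD (setIidPr sxy) cards2 nxy.
have := subset_leq_card sxy; rewrite cards2 nxy /=.
by case: #|T| => [|[|m]] //; rewrite !subSS subn0.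
Qed.

Lemma Reach_peg S t : t \in S -> Reach S t.
Proof. by move=> tS; exists S; split=> //; apply: rt_refl. Qed.

Lemma Reach_trans S T t :
  clos_refl_trans _ (@pegging_move G) S T -> Reach T t -> Reach S t.
Proof. by move=> ST [U [TU tU]]; exists U; split=> //; apply: rt_trans ST TU. Qed.

(** Induction from the front of the sequence: a derivation from the position after the first move
    becomes one from [S] by exchanging the new peg [z] for [x] and [y]. *)
Lemma derives_Reach S t : Reach S t -> derives S t.
Proof.
case=> T [/(clos_rt_rt1n _ _ _ _) ST tT]; elim: ST tT => {S T} [S|S S' T mv _ IH] tT.
  exact: derives_peg.
case: mv IH => x [y [z [[xS yS /eqP nxy xy] [zS yz ->]]]] /(_ tT) R'.
have nxz : x != z by apply: contraNneq zS => <-.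
have nyz : y != z by apply: contraNneq zS => <-.
apply: derives_sub (derives_exchange _ _ nxy xy yz R').
- apply/subsetP=> a; rewrite !inE => /orP[|/orP[]/eqP -> //].
  by case/andP=> /negbTE->; rewrite orbF => /andP[].
- by rewrite !inE eqxx (negbTE nxz).
- by rewrite !inE eqxx (negbTE nyz) orbT.
Qed.

(** * Realizing two disjoint derivations by proper moves *)

Section Induction.
Variable n : nat.
Hypothesis smaller_Reach : forall S t, #|S| < n -> derives S t -> Reach S t.

Lemma derives_pair_step T S1 S2 u v : #|T| <= n ->
    S1 \subset T -> S2 \subset T -> [disjoint S1 & S2] ->
    derives S1 u -> derives S2 v -> u \notin T ->
  exists T' S1' S2', pegging_move T T' /\
    [/\ S1' \subset T', S2' \subset T', [disjoint S1' & S2'],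
        derives S1' u & derives S2' v].
Proof.
move=> leTn; have [k] := ubnP #|S1|.
elim: k S1 S2 => // k IH S1 S2 leS1 s1 s2 dis R1 R2 uT.
(* [S2] supports a derivation, hence is nonempty, so [S1] is strictly smaller than [T]. *)
have ltS1 : #|S1| < n.
  apply: leq_trans leTn; apply: leq_trans (_ : #|S1 :|: S2| <= _).
    rewrite cardsU (disjoint_setI0 dis) cards0 subn0 -addn1 leq_add2l.
    exact: derives_card_gt0 R2.
  by apply: subset_leq_card; rewrite subUset s1.
have [U [/(clos_rt_rt1n _ _ _ _) S1U uU]] := smaller_Reach ltS1 R1.
(* The sequence has a first move, since [u] lies outside [T] and so outside [S1]. *)
have [S' mv RS'] : exists2 S', pegging_move S1 S' & derives S' u.
  case: S1U s1 uU uT => [s1 uU /negP[]|S' U' mv S'U' _ uU _].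
    exact: (subsetP s1).
  exists S' => //; apply: derives_Reach; exists U'; split=> //.
  exact: clos_rt1n_rt.
have ltS' := pegging_move_card mv.
case: mv ltS' RS' => x [y [z [[xS yS nxy xy] [zS yz ->]]]] ltS' RS'.
have nxz : x != z by apply: contraNneq zS => <-.
have nyz : y != z by apply: contraNneq zS => <-.
have x2 : x \notin S2 by rewrite (disjointFr dis xS).
have y2 : y \notin S2 by rewrite (disjointFr dis yS).
have [zT|zT] := boolP (z \in T).
  (* [S2] may lack [z]: the exchange then only adds [x] and [y] to it. *)
  apply: (IH (S1 :\: [set x; y] :|: [set z]) (S2 :\ z :|: [set x; y])) => //.
  - exact: leq_trans ltS' leS1.
  - by rewrite subUset sub1set zT (subset_trans (subsetDl _ _)).
  - rewrite subUset (subset_trans (subsetDl _ _)) //= subUset !sub1set.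
    by rewrite !(subsetP s1).
  - rewrite disjoints_subset; apply/subsetP=> a; rewrite !inE.
    case/orP=> [/andP[/negbTE-> aS]|/eqP->].
      by rewrite (disjointFr dis aS) andbF.
    by rewrite eqxx /= ![z == _]eq_sym (negbTE nxz) (negbTE nyz).
  - by apply: derives_exchange => //; apply/eqP.
(* Here [z] is free in [T], hence outside [S2], and [x], [y] belong to [S1]: the move leaves [S2]
   intact. *)
exists (T :\: [set x; y] :|: [set z]), (S1 :\: [set x; y] :|: [set z]), S2.
split; first by exists x, y, z; do 2!split=> //; apply: (subsetP s1).
split=> //; first exact/setSU/setSD.
- apply/subsetP=> a aS; rewrite !inE (subsetP s2) // andbT.
  by case: eqP aS x2 => [-> -> //|_ aS _]; case: eqP aS y2 => [-> ->|].
- rewrite disjoints_subset; apply/subsetP=> a; rewrite !inE.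
  case/orP=> [/andP[_ aS]|/eqP->]; first by rewrite (disjointFr dis aS).
  by apply: contra zT => /(subsetP s2).
Qed.

(** A move made for one target may take a peg off the other, but both remain derivable from disjoint
    sets and [#|T|] falls, so the process stops, with both occupied. *)
Lemma derives_pair_Reach T S1 S2 u v : #|T| <= n ->
    S1 \subset T -> S2 \subset T -> [disjoint S1 & S2] ->
    derives S1 u -> derives S2 v ->
  exists T', [/\ clos_refl_trans _ (@pegging_move G) T T', u \in T' & v \in T'].
Proof.
have [k] := ubnP #|T|.
elim: k T S1 S2 => // k IH T S1 S2 leT leTn s1 s2 dis R1 R2.
have next T' S1' S2' : pegging_move T T' ->
    [/\ S1' \subset T', S2' \subset T', [disjoint S1' & S2'],
        derives S1' u & derives S2' v] ->
    exists T', [/\ clos_refl_trans _ (@pegging_move G) T T',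
                   u \in T' & v \in T'].
  move=> mv [s1' s2' dis' R1' R2']; have lt := pegging_move_card mv.
  have [|| U [T'U uU vU]] := IH T' S1' S2' _ _ s1' s2' dis' R1' R2'.
  - exact: leq_trans lt leT.
  - exact: leq_trans (ltnW lt) leTn.
  by exists U; split=> //; apply: rt_trans (rt_step _ _ _ _ mv) T'U.
have [uT|uT] := boolP (u \in T); last first.
  have [T' [S1' [S2' [mv R']]]] := derives_pair_step leTn s1 s2 dis R1 R2 uT.
  exact: next mv R'.
have [vT|vT] := boolP (v \in T); first by exists T; split=> //; apply: rt_refl.
rewrite disjoint_sym in dis.
have [T' [S2' [S1' [mv [? ? dis' ? ?]]]]] :=
  derives_pair_step leTn s2 s1 dis R2 R1 vT.
by apply: (next T' S1' S2' mv); split=> //; rewrite disjoint_sym.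
Qed.

End Induction.

Lemma Reach_derives S t : derives S t -> Reach S t.
Proof.
have [n] := ubnP #|S|; elim: n S t => // n IH S t leS RS.
case: RS leS => {S t} [S t tS _|S S1 S2 u v w s1 s2 dis uv vw R1 R2].
  exact: Reach_peg.
rewrite ltnS => leS.
have [T [ST uT vT]] := derives_pair_Reach IH leS s1 s2 dis R1 R2.
apply: Reach_trans ST _.
(* With [u] and [v] both occupied, the last jump is legal unless [w] already carries a peg. *)
have [wT|wT] := boolP (w \in T); first exact: Reach_peg.
exists (T :\: [set u; v] :|: [set w]); split; last by rewrite !inE eqxx orbT.
apply: rt_step; exists u, v, w; do 2!split=> //.
by move=> euv; rewrite euv adj_irr in uv.
Qed.

End Derivations.

(** * Histories of labeled pegs and the two inclusions *)

Section LabeledPegs.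
Variable G : sgraph.
Local Open Scope fset_scope.
Implicit Types (D : {set G}) (M N : {fset (G * int)}) (f : int -> {set G}).

(* [f i] is the set of original pegs that were consumed to bring peg [i] to its
   current vertex. *)
Definition peg_history D M f : Prop :=
  [/\ forall i, f i \subset D,
      forall u i, (u, i) \in M -> derives (f i) u
    & forall u v i j, (u, i) \in M -> (v, j) \in M -> i != j ->
        [disjoint f i & f j]%B].

(** Serves stacking and, with [v = u], pebbling. A label occurs at most once in [M], so the
    surviving pegs have labels other than [i] and [j], and the union of both histories can be
    credited to [i]. *)
Lemma peg_history_merge D M f u v w i j :
    is_multidist M -> peg_history D M f -> (u, i) \in M -> (v, j) \in M ->
    derives (f i :|: f j) w ->
  peg_history D (M `\` [fset (u, i); (v, j)] `|` [fset (w, i)])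
    (fun k => if k == i then f i :|: f j else f k).
Proof.
move=> M_ok [fD fR fdis] uM vM Rw.
have other x k : (x, k) \in M `\` [fset (u, i); (v, j)] ->
    [/\ (x, k) \in M, k != i & k != j].
  rewrite !in_fsetE negb_or => /andP[/andP[nu nv] xM]; split=> //.
    by apply: contraNneq nu => ek; rewrite ek in xM *; rewrite (M_ok _ _ _ xM uM).
  by apply: contraNneq nv => ek; rewrite ek in xM *; rewrite (M_ok _ _ _ xM vM).
have fdisU x k : (x, k) \in M -> k != i -> k != j -> [disjoint f k & f i :|: f j]%B.
  move=> xM nki nkj; rewrite -setI_eq0 setIUr setU_eq0 !setI_eq0.
  by rewrite (fdis _ _ _ _ xM uM nki) (fdis _ _ _ _ xM vM nkj).
split=> [k|x k|x y k m].
- by case: ifP => // _; rewrite subUset !fD.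
- case/fsetUP=> [/other[xM /negbTE-> _]|/fset1P[-> ->]]; first exact: fR.
  by rewrite eqxx.
case/fsetUP=> [/other[xM nki nkj]|/fset1P[_ ->]];
    case/fsetUP=> [/other[yM nmi nmj]|/fset1P[_ ->]]; rewrite ?eqxx //.
- by rewrite (negbTE nki) (negbTE nmi); apply: fdis xM yM.
- by rewrite (negbTE nki) => _; apply: fdisU xM nki nkj.
- by rewrite (negbTE nmi) disjoint_sym => _; apply: fdisU yM nmi nmj.
Qed.

Lemma multi_move_peg_history D M N f : multi_move M N -> peg_history D M f ->
  exists g, peg_history D N g.
Proof.
case=> M_ok mv hist; have [fD fR fdis] := hist.
case: mv => [[u [v [w [i [j [[nuv nuw nvw] [vu vw uM vM ->]]]]]]]|
             [u [w [i [j [[nuw uw nij] [uM vM ->]]]]]]|[u [i [uM ->]]]].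
- eexists; apply: peg_history_merge => //.
  have nij : i != j.
    by apply/eqP=> eij; rewrite -eij in vM; apply: nuv; apply: M_ok uM vM.
  apply: (derives_jump (subsetUl _ _) (subsetUr _ _) _ _ vw (fR _ _ uM) (fR _ _ vM)).
    exact: fdis uM vM nij.
  by rewrite adj_sym.
- eexists; apply: peg_history_merge => //.
  apply: (derives_pebbling _ uw (fR _ _ uM) (fR _ _ vM)).
  by apply: fdis uM vM _; apply/eqP.
- exists f; split=> // [x k /fsetD1P[_]|x y k m /fsetD1P[_ xM] /fsetD1P[_ yM]].
    exact: fR.
  exact: fdis xM yM.
Qed.

Lemma label_dist_peg_history (l : G -> int) D :
  peg_history D (label_dist l D) (fun i => [set x in D | l x == i]).
Proof.
split=> [i|u i|u v i j _ _ nij].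
- by apply/subsetP=> x; rewrite inE => /andP[].
- case/imfsetP=> x /= xD [-> ->].
  by apply: derives_peg; rewrite inE xD eqxx.
- rewrite disjoints_subset; apply/subsetP=> x; rewrite !inE => /andP[-> /eqP->].
  by rewrite nij.
Qed.

(** A proper jump is imitated by stacking; that [w] is empty makes it distinct from [u] and [v]. *)
Lemma pegging_move_multi_move D D' M : pegging_move D D' -> is_multidist M ->
    (forall x, x \in D -> exists i, (x, i) \in M) ->
  exists2 M', multi_move M M' & forall x, x \in D' -> exists i, (x, i) \in M'.
Proof.
case=> u [v [w [[uD vD nuv uv] [wD vw ->]]]] M_ok DM.
have [[i uM] [j vM]] := (DM _ uD, DM _ vD).
exists (M `\` [fset (u, i); (v, j)] `|` [fset (w, i)]).
  split=> //; apply: Or31; exists u, v, w, i, j; do 2!split=> //.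
  - by move=> e; rewrite -e uD in wD.
  - by move=> e; rewrite -e vD in wD.
  - by rewrite adj_sym.
move=> x; rewrite !inE negb_or => /orP[/andP[/andP[nxu nxv] xD]|/eqP->].
  have [k xM] := DM _ xD; exists k; rewrite !in_fsetE xM !xpair_eqE.
  by rewrite (negbTE nxu) (negbTE nxv).
by exists i; rewrite !in_fsetE eqxx orbT.
Qed.

Lemma Reach_sub_Reach_a (l : G -> int) D t :
  {in D &, injective l} -> Reach D t -> Reach_a l D t.
Proof.
move=> l_inj [D' [/(clos_rt_rt1n _ _ _ _) DD' tD']].
have := label_dist_multidist l_inj.
have : forall x, x \in D -> exists i, (x, i) \in label_dist l D.
  by move=> x xD; exists (l x); apply/imfsetP; exists x.
rewrite /Reach_a; move: (label_dist l D) => M.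
elim: DD' M tD' => {D D' l_inj} [D|D D1 D' mv _ IH] M tD DM M_ok.
  by exists M; split; [apply: rt_refl|apply: DM].
have [M1 mv1 DM1] := pegging_move_multi_move mv M_ok DM.
have [M' [M1M' tM']] := IH M1 tD DM1 (multi_move_multidist mv1).
by exists M'; split=> //; apply: rt_trans (rt_step _ _ _ _ mv1) M1M'.
Qed.

Lemma Reach_a_sub_Reach (l : G -> int) D t : Reach_a l D t -> Reach D t.
Proof.
case=> M [/(clos_rt_rt1n _ _ _ _) DM [i tM]].
have [f hist] : exists f, peg_history D M f.
  have : exists f, peg_history D (label_dist l D) f.
    by eexists; apply: label_dist_peg_history.
  elim: DM {tM} => // M1 M2 M3 mv _ IH [f hist].
  exact: IH (multi_move_peg_history mv hist).
have [fD fR _] := hist.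
exact/Reach_derives/(derives_sub (fD i))/fR.
Qed.

End LabeledPegs.

Theorem theorem2p5 (G : sgraph) (D : {set G}) (l : G -> int)
    (l_inj : {in D &, injective l}) :
  Reach_a l D = Reach D.
Proof.
apply/seteqP; split=> t; first exact: Reach_a_sub_Reach.
exact: Reach_sub_Reach_a.
Qed.
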